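(* Let $X=[0,1]\subset\mathbb{R}$ and let $\boldsymbol{\xi},\boldsymbol{\xi}^1,\boldsymbol{\xi}^2,\ldots$ be iid random variables on a complete probability space $(\Omega,\mathcal{F},\mathbb{P})$, each uniformly distributed on $\Xi=[0,1]$. There exist a Carathéodory function $f:\Xi\times\mathbb{R}\to\mathbb{R}$ and a sequence $\delta^\nu\in(0,1]$, $\nu\in\mathbb{N}$, with $\delta^\nu\downarrow 0$, such that the following hold. (a) For any $\xi\in\Xi$, the function $f(\xi,\cdot)$ is $1$-Lipschitz on $\mathbb{R}$. (b) For any $x\in\mathbb{R}$, $|\mathbb{E}[f(\boldsymbol{\xi},x)]|<\infty$. (c) For any $\nu\in\mathbb{N}$, the set $D^\nu=\{x\in X\mid f(\xi,\cdot)\text{ is }C^1\text{ on }\mathbb{B}(x,\delta^\nu)\text{ for all }\xi\in\Xi\}$ is nonempty. (d) $\mathbb{P}$-almost surely, one has $$\liminf_{\nu\to\infty}\ \sup_{x\in D^\nu}\ \inf_{y,\hat y\in\mathbb{B}(x,\delta^\nu)}\Big|\mathbb{E}[\nabla_x f(\boldsymbol{\xi},y)]-\frac1\nu\sum_{i=1}^\nu\nabla_x f(\boldsymbol{\xi}^i,\hat y)\Big|\ \ge\ \frac12 .$$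
   Context: $\mathbb{N}=\{1,2,\ldots\}$. $\mathbb{B}(x,r)=\{y\mid |y-x|\le r\}$ is the closed ball. A function $f:\Xi\times\mathbb{R}\to\mathbb{R}$ is Carathéodory if $f(\xi,\cdot)$ is continuous for each $\xi$ and $f(\cdot,x)$ is Borel measurable for each $x$. $\nabla_x f(\xi,y)$ denotes the gradient (here the derivative) of $f(\xi,\cdot)$ at $y$. ''$f(\xi,\cdot)$ is $C^1$ on $\mathbb{B}(x,\delta)$'' means that $f(\xi,\cdot)$ is differentiable at every point of $\mathbb{B}(x,\delta)$ and $\nabla_x f(\xi,\cdot)$ is continuous on $\mathbb{B}(x,\delta)$. ''$\mathbb{P}$-almost surely'' means for all $\omega$ in a set of $\mathbb{P}$-probability one (the probability space is complete). *)

(* Defs.v *)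
From HB Require Import structures.
From mathcomp Require Import all_boot all_order all_algebra finmap.
From mathcomp Require Import all_classical all_reals all_analysis.

Set Implicit Arguments.
Unset Strict Implicit.
Unset Printing Implicit Defensive.

Import Order.TTheory GRing.Theory Num.Theory.
Import numFieldNormedType.Exports.

Local Open Scope classical_set_scope.
Local Open Scope ring_scope.

Definition mutually_independent (d : measure_display) (Omega : measurableType d)
    (R : realType) (P : probability Omega R) (I : choiceType)
    (X : I -> {RV P >-> R}) : Prop :=
  forall (J : {fset I}) (A : I -> set R), (forall i, measurable (A i)) ->
    P (\bigcap_(i in [set` J]) (X i @^-1` A i)) =
    (\prod_(i <- J) P (X i @^-1` A i))%E.

Definition uniformly_distributed01 (d : measure_display)
    (Omega : measurableType d) (R : realType) (P : probability Omega R)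
    (X : {RV P >-> R}) : Prop :=
  forall A : set R, measurable A ->
    distribution P X A = uniform_prob (@ltr01 R) A.

(* A function on Xi x R is represented by a total function on R x R whose
   values at first arguments outside of Xi are unconstrained. *)
Definition caratheodory (R : realType) (Xi : set R) (f : R -> R -> R) : Prop :=
  (forall xi, Xi xi -> continuous (f xi)) /\
  (forall x, measurable_fun Xi (fun xi => f xi x)).

Definition cball (R : realType) (x r : R) : set R :=
  [set y | `|y - x| <= r].

(* The derivative is the two-sided one at every point of B, boundary included;
   only its continuity is relative to B. *)
Definition C1_on (R : realType) (B : set R) (g : R -> R) : Prop :=
  (forall y, B y -> derivable g y 1) /\ {within B, continuous (derive1 g)}.

Definition C1_points (R : realType) (X Xi : set R) (f : R -> R -> R) (r : R) :
    set R :=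
  [set x | X x /\ forall xi, Xi xi -> C1_on (cball x r) (f xi)].

(* xi 0 is the reference random variable; xi 1, ..., xi nu are the samples. *)
Definition gradient_gap (d : measure_display) (Omega : measurableType d)
    (R : realType) (P : probability Omega R) (xi : nat -> {RV P >-> R})
    (f : R -> R -> R) (nu : nat) (omega : Omega) (y yhat : R) : \bar R :=
  (`| 'E_P[fun w => derive1 (f (xi 0%N w)) y] -
      (nu%:R^-1 * \sum_(1 <= i < nu.+1) derive1 (f (xi i omega)) yhat)%:E |)%E.

(* Main.v *)
Require Import Defs.
From HB Require Import structures.
From mathcomp Require Import all_boot all_order all_algebra finmap.
From mathcomp Require Import all_classical all_reals all_analysis.
From mathcomp Require Import measurable_realfun ring lra.

Set Implicit Arguments.
Unset Strict Implicit.
Unset Printing Implicit Defensive.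

Import Order.TTheory GRing.Theory Num.Theory.
Import numFieldNormedType.Exports.

Local Open Scope classical_set_scope.
Local Open Scope ring_scope.

(** Cut [0, 1] into 2n cells of equal length. Any n sample points lie in a union
    of n cells, which has probability at most 1/2, and only finitely many such
    unions exist for a given n. Enumerate all these unions, over all n, as
    A_0, A_1, ..., and let f(z, .) be the sum over k of 1_{A_k}(z) times a tent
    of slope +-1 around 4^-k, the tents having disjoint supports. On the rising
    part of the k-th tent the derivative of f(z, .) is 1_{A_k}(z), of mean at
    most 1/2; yet for every sample of size nu some k below a bound K(nu) gives
    an empirical mean equal to 1. Choosing delta^nu small enough to put a
    delta^nu-ball inside the rising part of each of the first K(nu) tents, the
    bound holds surely, whatever the joint law of the sample. *)

(** * Unions of grid cells under the uniform law *)

Section Uniform.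
Variable R : realType.
Local Notation U := (uniform_prob (@ltr01 R)).

Lemma uniform_prob01_itv (a b : R) : a <= b -> (U `[a, b] <= (b - a)%:E)%E.
Proof.
move=> ab; have -> : ((b - a)%:E = \int[lebesgue_measure]_(x in `[a, b]) 1)%E.
  rewrite integral_cst//= mul1e lebesgue_measure_itv/= lte_fin.
  by case: ltgtP ab => // -> _; rewrite subrr.
apply: ge0_le_integral => //=.
- by move=> x _; rewrite lee_fin uniform_pdf_ge0.
- apply/measurable_EFinP; apply: measurable_funTS.
  exact: measurable_uniform_pdf.
- by move=> x _; rewrite lee_fin /uniform_pdf subr0 invr1; case: ifP.
Qed.

Lemma uniform_prob01_setC : U (~` `[0, 1]) = 0%E.
Proof.
apply: integral0_eq => x /= /negP; rewrite in_itv/= /uniform_pdf.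
by move=> /negbTE ->.
Qed.

Definition grid_cell (m j : nat) : set R := `[j%:R / m%:R, j.+1%:R / m%:R].

(* The points outside of [0, 1] are included so that covering a sample never
   requires knowing that it lies in [0, 1]. *)
Definition grid_union (s : seq nat) : set R :=
  ~` `[0, 1] `|` \big[setU/set0]_(j <- s) grid_cell (size s).*2 j.

Lemma measurable_grid_cells m (s : seq nat) :
  measurable (\big[setU/set0]_(j <- s) grid_cell m j).
Proof. by apply: bigsetU_measurable => j _; exact: measurable_itv. Qed.

Lemma measurable_grid_union s : measurable (grid_union s).
Proof.
apply: measurableU; last exact: measurable_grid_cells.
by apply: measurableC; exact: measurable_itv.
Qed.

Lemma uniform_prob01_grid_cells m (s : seq nat) :
  (U (\big[setU/set0]_(j <- s) grid_cell m j) <= ((size s)%:R / m%:R)%:E)%E.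
Proof.
elim: s => [|j s IH]; first by rewrite big_nil measure0 mul0r.
rewrite big_cons; apply: (le_trans (measureU2 _ _ _)).
- exact: measurable_itv.
- exact: measurable_grid_cells.
have -> : ((size (j :: s))%:R / m%:R)%:E
    = ((j.+1%:R / m%:R - j%:R / m%:R)%:E + ((size s)%:R / m%:R)%:E)%E :> \bar R.
  by rewrite -EFinD /= -!natr1; congr EFin; ring.
apply: leeD => //; apply: uniform_prob01_itv.
by rewrite ler_wpM2r// ler_nat.
Qed.

(** The mesh is tied to the length of [s]: [size s] cells of length [1 / (2 * size s)], overlapping
    or not, weigh at most 1/2 together, and the complement of [0, 1] is null. *)
Lemma uniform_prob01_grid_union s : (U (grid_union s) <= (2^-1)%:E)%E.
Proof.
apply: (le_trans (measureU2 _ _ _)).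
- by apply: measurableC; exact: measurable_itv.
- exact: measurable_grid_cells.
rewrite [X in (X + _)%E]uniform_prob01_setC add0e.
apply: (le_trans (uniform_prob01_grid_cells _ _)).
rewrite lee_fin -mul2n natrM; case: (size s) => [|n]; first by rewrite mul0r.
by rewrite invfM mulrCA mulfV// mulr1.
Qed.

Lemma grid_cell_cover m (z : R) : `[0, 1]%classic z ->
  exists j : 'I_m.+1, grid_cell m.+1 j z.
Proof.
rewrite /= in_itv/= => /andP[z0]; rewrite le_eqVlt => /predU1P[->|z1].
  (* At [z = 1] truncation would give the index [m.+1], one too many; the last cell is closed and
     contains 1. *)
  exists ord_max; rewrite /grid_cell /= in_itv/=.
  by rewrite divff// lexx andbT ler_pdivrMr// mul1r ler_nat.
have mz0 : 0 <= z * m.+1%:R by exact: mulr_ge0.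
have jm : (Num.truncn (z * m.+1%:R) < m.+1)%N.
  by rewrite truncn_lt_nat// -[ltRHS]mul1r ltr_pM2r.
exists (Ordinal jm); rewrite /grid_cell /= in_itv/=.
have /andP[lez ltz] := truncn_itv mz0.
by rewrite ler_pdivrMr// lez ler_pdivlMr// ltW.
Qed.

(** Pickling lists of naturals puts the unions for all sample sizes into one sequence. A number that
    codes no list yields the empty list, hence a null set. *)
Definition grid_family (k : nat) : set R :=
  grid_union (odflt [::] (choice.unpickle k)).

(** [K] is uniform in [z] because [n] points select one of finitely many [n]-tuples of cell indices;
    [K] is the largest code of such a tuple. *)
Lemma grid_family_cover (n : nat) : (0 < n)%N -> exists K, forall z : nat -> R,
  exists2 k, (k <= K)%N & forall i, (i < n)%N -> grid_family k (z i).
Proof.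
case: n => // n _.
exists (\max_(t : n.+1.-tuple 'I_n.+1.*2) choice.pickle (map val t)) => z.
have /choice[j jz] : forall i : nat, exists j : 'I_n.+1.*2,
    `[0, 1]%classic (z i) -> grid_cell n.+1.*2 j (z i).
  move=> i; have [zi|nzi] := pselect (`[0, 1]%classic (z i)).
    by have [j] := grid_cell_cover n.*2.+1 zi; exists j.
  (* A dummy index: a point outside [0, 1] belongs to every [grid_union]. *)
  by exists ord0.
set t := [tuple j i | i < n.+1].
exists (choice.pickle (map val t)); first exact: (leq_bigmax t).
move=> i ilt; rewrite /grid_family choice.pickleK/= /grid_union.
have [zi|] := pselect (`[0, 1]%classic (z i)); [right|by left].
rewrite -bigcup_seq; exists (val (j i)).
  apply/map_f; apply/mapP; exists (Ordinal ilt) => //.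
  by rewrite mem_enum.
by rewrite size_map size_tuple card_ord; exact: jz.
Qed.

End Uniform.

(** * Tents with disjoint supports and their derivatives *)

Section Tents.
Variable R : realType.
Implicit Types (x y z : R) (k : nat).

Definition peak k : R := 4^-1 ^+ k.

Definition tent k x : R := Num.max 0 (peak k / 2 - `|x - peak k|).

Lemma peak_gt0 k : 0 < peak k. Proof. by rewrite exprn_gt0// invr_gt0. Qed.

Lemma peak_le j k : (j <= k)%N -> peak k <= peak j.
Proof.
by move=> jk; rewrite /peak ler_wiXn2l// ?invr_ge0// invf_le1// ler1n.
Qed.

Lemma peak_le1 k : peak k <= 1.
Proof. by have := peak_le (leq0n k); rewrite {2}/peak expr0. Qed.

Lemma tent_ge0 k x : 0 <= tent k x. Proof. by rewrite le_max lexx. Qed.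

Lemma tent_le1 k x : tent k x <= 1.
Proof.
rewrite ge_max ler01/=; have := peak_le1 k; have := normr_ge0 (x - peak k).
by have := peak_gt0 k; lra.
Qed.

Lemma tent_lip k x y : tent k x <= tent k y + `|x - y|.
Proof.
rewrite ge_max addr_ge0 ?tent_ge0//=.
have : peak k / 2 - `|y - peak k| <= tent k y by rewrite le_max lexx orbT.
have : `|y - peak k| <= `|y - x| + `|x - peak k|.
  exact: ler_distD.
by rewrite (distrC y x); lra.
Qed.

Lemma tent_rising k x : peak k / 2 < x < peak k ->
  tent k x = x - peak k / 2.
Proof.
move=> /andP[kx xk]; rewrite /tent ltr0_norm; last lra.
by rewrite max_r; lra.
Qed.

(** [tent k] is positive only between 1/2 and 3/2 times [peak k]. Later peaks are at most
    [peak j / 4], so their tents end by [3/8 * peak j], before [tent j] begins. *)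
Lemma tent_disjoint j k x : 0 < tent j x -> 0 < tent k x -> j = k.
Proof.
wlog jk : j k / (j < k)%N => [hw|].
  by case: (ltngtP j k) => // jk hj hk; [exact: hw|exact/esym/hw].
rewrite !lt_max ltxx/= => tj tk.
have hk : peak k <= peak j / 4.
  by apply: (le_trans (peak_le jk)); rewrite /peak exprSr.
have h1 := ler_norm (x - peak k); have h2 := ler_norm (- (x - peak j)).
by exfalso; move: (peak_gt0 j) h2; rewrite normrN; lra.
Qed.

Variable A : nat -> set R.

(* The tents have disjoint supports, so this supremum is also their sum. *)
Definition tents z x : R := sup (range (fun k => \1_(A k) z * tent k x)).

Lemma has_sup_tents z x : has_sup (range (fun k => \1_(A k) z * tent k x)).
Proof.
split; first by eexists; exists 0%N.
exists 1 => _ [k _ <-]; rewrite indicE.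
by case: (z \in A k); rewrite ?mul1r ?mul0r ?tent_le1.
Qed.

Lemma tents_lip z x y : tents z x <= tents z y + `|x - y|.
Proof.
apply: ge_sup; first by eexists; exists 0%N.
move=> _ [k _ <-].
have : \1_(A k) z * tent k y <= tents z y.
  by apply: ub_le_sup; [exact: (has_sup_tents z y).2|exists k].
have := tent_lip k x y; have := normr_ge0 (x - y); rewrite indicE.
by case: (z \in A k); rewrite ?mul1r ?mul0r; lra.
Qed.

Lemma lipschitz_tents z : 1.-lipschitz (tents z).
Proof.
move=> [x y] _ /=; rewrite mul1r ler_norml.
by have := tents_lip z x y; have := tents_lip z y x; rewrite (distrC y x); lra.
Qed.

Lemma continuous_tents z : continuous (tents z).
Proof.
move=> x; apply/cvgrPdist_le => e e0; near=> y.
have /= := @lipschitz_tents z (x, y) (conj I I).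
rewrite mul1r => /le_trans; apply.
by near: y; apply: cvgr_dist_le => //; exact: cvg_id.
Unshelve. all: by end_near. Qed.

Lemma tents_active k z x : 0 < tent k x -> tents z x = \1_(A k) z * tent k x.
Proof.
move=> tk; apply/eqP; rewrite eq_le; apply/andP; split.
  apply: ge_sup; first by eexists; exists 0%N.
  move=> _ [j _ <-]; have [->//|jk] := eqVneq j k.
  have -> : tent j x = 0.
    apply/eqP; rewrite eq_le tent_ge0 andbT leNgt; apply/negP => tj.
    by rewrite (tent_disjoint tj tk) eqxx in jk.
  by rewrite mulr0 mulr_ge0 ?tent_ge0// indicE.
by apply: ub_le_sup; [exact: (has_sup_tents z x).2|exists k].
Qed.

(** At most one tent is active at [x], and [k] and [c] depend on [x] alone. Measurability in [z] and
    finiteness of the mean thus reduce to those of an indicator. *)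
Lemma tents_indic x :
  exists k, exists c : R, forall z, tents z x = \1_(A k) z * c.
Proof.
have [[k tk]|nt] := pselect (exists k, 0 < tent k x).
  by exists k, (tent k x) => z; exact: tents_active.
have t0 k : tent k x = 0.
  apply/eqP; rewrite eq_le tent_ge0 andbT leNgt; apply/negP => tj.
  by apply: nt; exists k.
exists 0%N, 0 => z; rewrite mulr0 /tents.
have -> : range (fun k => \1_(A k) z * tent k x) = [set 0]; last exact: sup1.
apply/seteqP; split => [_ [k _ <-]|_ ->] /=; first by rewrite t0 mulr0.
by exists 0%N => //; rewrite t0 mulr0.
Qed.

Lemma is_derive_tents k z x : peak k / 2 < x < peak k ->
  is_derive x 1 (tents z) (\1_(A k) z).
Proof.
move=> /andP[kx xk].
(* Near [x] the function coincides with this affine ramp. *)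
have ramp : is_derive x 1 (\1_(A k) z *: (id - cst (peak k / 2)) : R -> R)
    (\1_(A k) z).
  by apply: is_derive_eq; rewrite subr0 [_ *: _]mulr1.
apply: near_eq_is_derive ramp.
near=> y.
have ky : peak k / 2 < y < peak k.
  by apply/andP; split; near: y; [exact: lt_nbhsr|exact: lt_nbhsl].
rewrite (@tents_active k) tent_rising//; last by move: ky; lra.
Unshelve. all: by end_near. Qed.

(** The midpoint of the rising part, at distance [peak k / 4] from both ends; a ball of radius
    [peak k / 8] stays strictly inside. *)
Definition slope_point k : R := peak k * (3 / 4).

Lemma slope_ball k r x : r <= peak k / 8 -> cball (slope_point k) r x ->
  peak k / 2 < x < peak k.
Proof.
rewrite /cball /slope_point /= => rk; rewrite ler_norml.
by have := peak_gt0 k; lra.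
Qed.

Lemma derive1_tents k r z x : r <= peak k / 8 ->
  cball (slope_point k) r x -> derive1 (tents z) x = \1_(A k) z.
Proof.
move=> rk /(slope_ball rk) xk; rewrite derive1E.
by have [_ ->] := is_derive_tents z xk.
Qed.

Lemma C1_points_tents (Xi : set R) k r : r <= peak k / 8 ->
  C1_points `[0, 1]%classic Xi tents r (slope_point k).
Proof.
move=> rk; split.
  rewrite /= in_itv/= /slope_point; have := peak_gt0 k.
  by have := peak_le1 k; lra.
move=> z _; split.
  by move=> y /(slope_ball rk) yk; have [] := is_derive_tents z yk.
(* The derivative is constant on the ball. *)
apply: (@subspace_eq_continuous R _ R (cst (\1_(A k) z))); last first.
  by move=> y; exact: cvg_cst.
by move=> y; rewrite inE => yB; rewrite /from_subspace (derive1_tents z rk yB).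
Qed.

End Tents.

(** * Assembling the counterexample *)

Lemma limn_einf_ge (R : realType) (u : nat -> \bar R) (l : \bar R) N :
  (forall n, (N <= n)%N -> (l <= u n)%E) -> (l <= limn_einf u)%E.
Proof.
move=> lu; rewrite limn_einf_lim (cvg_lim _ (@cvg_einfs_sup _ u))//.
apply: (@le_trans _ _ (einfs u N)); last by apply: ereal_sup_ubound; exists N.
by apply: le_ereal_inf_tmp => _ [n /= Nn <-]; exact: lu.
Qed.

Lemma expectation_scaled_indic (d : measure_display) (Omega : measurableType d)
    (R : realType) (P : probability Omega R) (c : R) (A : set Omega) :
  measurable A -> ('E_P[fun w => (\1_A w * c)%R] = c%:E * P A)%E.
Proof.
move=> mA; rewrite -expectation_indic// -expectationZl//.
by apply/Lfun1_integrable; exact: integrable_indic.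
Qed.

Theorem theorem1 (R : realType) (d : measure_display)
    (Omega : measurableType d) (P : probability Omega R)
    (P_complete : measure_is_complete P)
    (xi : nat -> {RV P >-> R})
    (xi_indep : mutually_independent xi)
    (xi_unif : forall i, uniformly_distributed01 (xi i)) :
  let X : set R := `[0, 1]%classic in
  let Xi : set R := `[0, 1]%classic in
  exists (f : R -> R -> R) (delta : nat -> R),
    let D (nu : nat) : set R := C1_points X Xi f (delta nu) in
    caratheodory Xi f /\
    (forall nu, (0 < nu)%N -> 0 < delta nu <= 1) /\
    (forall mu nu, (0 < mu)%N -> (mu <= nu)%N -> delta nu <= delta mu) /\
    delta @ \oo --> (0 : R) /\
    (forall z, Xi z -> 1.-lipschitz (f z)) /\
    (forall x : R, (`| 'E_P[fun w => f (xi 0%N w) x] | < +oo)%E) /\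
    (forall nu, (0 < nu)%N -> D nu !=set0) /\
    {ae P, forall omega,
      ((2^-1)%:E <=
       limn_einf (fun nu => ereal_sup
         [set ereal_inf
           [set gradient_gap xi f nu omega p.1 p.2 |
              p in cball x (delta nu) `*` cball x (delta nu)]
         | x in D nu]))%E}.
Proof.
move=> X Xi; pose A := @grid_family R.
have mA k : measurable (A k) by exact: measurable_grid_union.
have mxiA k : measurable (xi 0%N @^-1` A k).
  by rewrite -[_ @^-1` _]setTI; exact: measurable_funP.
have PA k : (P (xi 0%N @^-1` A k) <= (2^-1)%:E)%E.
  have := xi_unif 0%N _ (mA k); rewrite /distribution /pushforward => ->.
  exact: uniform_prob01_grid_union.
have Pfin k : P (xi 0%N @^-1` A k) \is a fin_num by exact: fin_num_measure.
have /choice[K HK] : forall n, exists K, (0 < n)%N -> forall z : nat -> R,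
    exists2 k, (k <= K)%N & forall i, (i < n)%N -> A k (z i).
  move=> [|n]; first by exists 0%N.
  by have [K] := grid_family_cover R (ltn0Sn n); exists K.
(* The partial sum dominates [K n] and is monotone; the summand [n] forces [depth], which goes to
   infinity, to send the radii to 0. *)
pose depth n := (n + \sum_(i < n.+1) K i)%N.
have depth_homo m n : (m <= n)%N -> (depth m <= depth n)%N.
  move=> mn; rewrite leq_add// -!(big_mkord xpredT K).
  by rewrite [leqRHS](@big_cat_nat _ _ _ m.+1)//= leq_addr.
have K_depth n : (K n <= depth n)%N.
  by rewrite /depth big_ord_recr/= addnA leq_addl.
pose delta n : R := peak R (depth n) / 8.
have delta_le n k : (k <= depth n)%N -> delta n <= peak R k / 8.
  by move=> kn; rewrite ler_wpM2r ?invr_ge0//; exact: peak_le.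
exists (tents A), delta => D.
refine (conj _ (conj _ (conj _ (conj _ (conj _ (conj _ (conj _ _))))))).
- split=> [z _|x]; first exact: continuous_tents.
  have [k [c /funext ->]] := tents_indic A x.
  by apply: measurable_funM => //; exact: measurable_indic.
- move=> nu _; rewrite /delta; have := peak_gt0 R (depth nu).
  by have := peak_le1 R (depth nu); lra.
- by move=> mu nu _ /depth_homo; exact: delta_le.
- apply: (@squeeze_cvgr _ _ _ _ (cst 0) (GRing.exp 4^-1)).
  + apply: nearW => n; have := peak_gt0 R (depth n).
    have := peak_le R (leq_addr (\sum_(i < n.+1) K i) n : (n <= depth n)%N).
    by rewrite /delta/= -[_ ^+ n]/(peak R n); lra.
  + exact: cvg_cst.
  + by apply: cvg_expr; rewrite ger0_norm// invf_lt1// ltr1n.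
- by move=> z _; exact: lipschitz_tents.
- move=> x; have [k [c fE]] := tents_indic A x.
  under eq_fun do rewrite fE.
  rewrite [X in 'E__[X]%E](_ : _ = fun w => \1_(xi 0%N @^-1` A k) w * c)//.
  by rewrite expectation_scaled_indic// -(fineK (Pfin k)) -EFinM ltry.
- move=> nu _; exists (slope_point R 0); apply: C1_points_tents.
  exact: delta_le.
(* The bound holds for every [omega] and every [nu >= 1]; the point of [D nu] that realizes it
   depends on [omega]. *)
apply: aeW => omega; apply: (@limn_einf_ge _ _ _ 1%N) => nu nu0.
(* The shift [i.+1] skips [xi 0], the reference variable. *)
have [k kK kxi] := HK _ nu0 (fun i => xi i.+1 omega).
have dk : delta nu <= peak R k / 8.
  by apply: delta_le; exact: leq_trans (K_depth nu).
apply: (@le_trans _ _ (ereal_inf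
  [set gradient_gap xi (tents A) nu omega p.1 p.2 |
    p in cball (slope_point R k) (delta nu) `*`
         cball (slope_point R k) (delta nu)])); last first.
  apply: ereal_sup_ubound; exists (slope_point R k) => //.
  exact: C1_points_tents.
apply: le_ereal_inf_tmp => _ [[y yhat] [/= yB yhatB] <-].
rewrite /gradient_gap.
under eq_fun do rewrite (derive1_tents A _ dk yB).
rewrite [X in 'E__[X]%E](_ : _ = fun w => \1_(xi 0%N @^-1` A k) w * 1);
  last first.
  by apply/funext => w; rewrite mulr1.
rewrite expectation_scaled_indic// mul1e.
(* All samples lie in [A k], so every slope at [yhat] is 1. *)
have -> : \sum_(1 <= i < nu.+1) derive1 (tents A (xi i omega)) yhat = nu%:R.
  rewrite big_add1/= (eq_big_nat _ _ (F2 := fun=> 1)).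
    by rewrite sumr_const_nat subn0.
  move=> i inu; rewrite (derive1_tents A _ dk yhatB) indicE mem_set//.
  exact: kxi.
rewrite mulVf ?pnatr_eq0 -?lt0n//.
(* The gap is now [|p - 1|] with [p <= 1/2]. *)
move: (PA k); rewrite -(fineK (Pfin k)) -EFinB /= !lee_fin => Pk.
rewrite ler0_norm; lra.
Qed.
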